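(* For every $\epsilon > 0$ and every pattern-avoiding class $\mathcal{C}$ of permutations, there exists a sequence $(\sigma_n)_{n \in \mathbb{N}}$ of permutations, $\sigma_n$ of length $n$, such that $|\pi_n| = o(n^{0.5+\epsilon})$, where $\pi_n$ is a longest permutation belonging to $\mathcal{C}$ that is a pattern of $\sigma_n$.
   Context: A permutation of length $n$ is a bijection of $[1..n]$, written $\sigma_1\cdots\sigma_n$. A permutation $\pi$ of length $k$ is a pattern of $\sigma$ of length $n$ if there are indices $1 \le i_1<\cdots<i_k \le n$ with $\sigma_{i_\ell} < \sigma_{i_m}$ whenever $\pi_\ell < \pi_m$; otherwise $\sigma$ avoids $\pi$. A pattern-avoiding class is a class of the form $S(\tau_1,\ldots,\tau_m)$ ($m \ge 1$), the set of all permutations avoiding each of the patterns $\tau_1,\ldots,\tau_m$. *)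

(* Defs.v *)
From mathcomp Require Import all_boot all_order all_algebra all_fingroup.
From mathcomp Require Import all_classical all_reals all_analysis.

Set Implicit Arguments.
Unset Strict Implicit.
Unset Printing Implicit Defensive.

(* A permutation of length n is an element of 'S_n: positions and values range
   over 0, ..., n-1 instead of 1, ..., n.  The empty permutation (n = 0) is
   allowed. *)

(* The map i lists the chosen positions i_1 < ... < i_k of sigma. *)
Definition is_pattern (k n : nat) (pi : 'S_k) (sigma : 'S_n) : Prop :=
  exists i : 'I_k -> 'I_n,
    (forall l m : 'I_k, (l < m)%N -> (i l < i m)%N) /\
    (forall l m : 'I_k, (pi l < pi m)%N -> (sigma (i l) < sigma (i m))%N).

Definition avoids (n k : nat) (sigma : 'S_n) (pi : 'S_k) : Prop :=
  ~ is_pattern pi sigma.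

Definition perm_class : Type := forall n : nat, 'S_n -> Prop.

(* C = S(tau_1, ..., tau_m) with m >= 1; the tau_j may have different lengths,
   hence the dependent pairs. *)
Definition pattern_avoiding_class (C : perm_class) : Prop :=
  exists taus : seq {k : nat & 'S_k},
    taus != [::] /\
    forall (n : nat) (sigma : 'S_n),
      C n sigma <-> (forall tau, tau \in taus -> avoids sigma (tagged tau)).

Definition longest_pattern_in (C : perm_class) (n : nat) (sigma : 'S_n)
    (k : nat) (pi : 'S_k) : Prop :=
  [/\ C k pi, is_pattern pi sigma &
      forall (j : nat) (rho : 'S_j), C j rho -> is_pattern rho sigma ->
        (j <= k)%N].

(* Main.v *)
(** The Marcus-Tardos argument bounds the number of permutations of length k
    avoiding a fixed tau by c^k.  A given rho of length k is contained in at most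
    C(n,k) n! / k! permutations of length n, so if c^k C(n,k) < k! then some
    sigma of length n contains no tau-avoiding pattern of length k, hence, tau-avoidance
    being hereditary, none of length >= k.  Since k^k <= 4^k k!, this happens as
    soon as k^2 > 16 c n, so the longest patterns have length O(sqrt n). *)

Require Import Defs.
From mathcomp Require Import all_boot all_fingroup zify.

Set Implicit Arguments.
Unset Strict Implicit.
Unset Printing Implicit Defensive.

(** * Containment of a permutation in a 0-1 matrix *)

Section Containment.

Variables (k : nat) (p : 'S_k).

(* A set of cells stands for the 0-1 matrix having its ones there. *)
Definition contains n (A : {set 'I_n * 'I_n}) : bool :=
  [exists r : {ffun 'I_k -> 'I_n}, exists c : {ffun 'I_k -> 'I_n},
    [&& [forall l : 'I_k, forall m : 'I_k, (l < m) ==> (r l < r m)],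
        [forall l : 'I_k, forall m : 'I_k, (l < m) ==> (c l < c m)] &
        [forall l, (r l, c (p l)) \in A]]].

Lemma containsP n (A : {set 'I_n * 'I_n}) :
  reflect (exists r c : 'I_k -> 'I_n,
             [/\ {homo r : l m / l < m}, {homo c : l m / l < m} &
                 forall l, (r l, c (p l)) \in A])
          (contains A).
Proof.
apply: (iffP existsP) => [[r /existsP[c /and3P[rP cP AP]]]|[r [c [rP cP AP]]]].
  exists r, c; split.
  - by move=> l m lm; move/forallP/(_ l)/forallP/(_ m)/implyP: rP; apply.
  - by move=> l m lm; move/forallP/(_ l)/forallP/(_ m)/implyP: cP; apply.
  - by move=> l; move/forallP: AP; apply.
exists (finfun r); apply/existsP; exists (finfun c); apply/and3P; split.
- by apply/forallP => l; apply/forallP => m; apply/implyP => lm; rewrite !ffunE rP.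
- by apply/forallP => l; apply/forallP => m; apply/implyP => lm; rewrite !ffunE cP.
- by apply/forallP => l; rewrite !ffunE.
Qed.

End Containment.

Definition transpose n (A : {set 'I_n * 'I_n}) : {set 'I_n * 'I_n} :=
  [set (a.2, a.1) | a in A].

Lemma mem_transpose n (A : {set 'I_n * 'I_n}) i j :
  ((i, j) \in transpose A) = ((j, i) \in A).
Proof.
apply/imsetP/idP => [[[a b] ? [-> ->]]//|jiA]; by exists (j, i).
Qed.

(** This carries bounds proved along one axis over to the other axis. *)
Lemma contains_transpose k (p : 'S_k) n (A : {set 'I_n * 'I_n}) :
  contains p^-1%g (transpose A) -> contains p A.
Proof.
case/containsP=> r [c [rP cP AP]]; apply/containsP; exists c, r; split=> // l.
by have := AP (p l); rewrite permK mem_transpose.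
Qed.

Lemma increasing_in_set n k (T : {set 'I_n}) :
  k <= #|T| -> exists t : 'I_k -> 'I_n,
    {homo t : l m / l < m} /\ forall l, t l \in T.
Proof.
(* For [k = 0] the type ['I_n] may be empty and offer no default element for [nth]. *)
case: k => [|k] kT.
  by exists (fun i => widen_ord (leq0n n) i); split; case.
have x0 : 'I_n by case: (set_0Vmem T) kT => [->|[x _]//]; rewrite cards0.
exists (fun l => nth x0 (enum T) l); split=> [l m lm|l]; last first.
  by rewrite -mem_enum mem_nth // -cardE (leq_trans _ kT).
have srt : sorted ltn (map val (enum T)).
  rewrite sorted_map /enum_mem; apply: sorted_filter => [? ? ?|]; first exact: ltn_trans.
  by rewrite -sorted_map -enumT val_enum_ord iota_ltn_sorted.
have := sorted_ltn_nth ltn_trans 0 srt.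
move=> /(_ l m); rewrite !inE size_map -cardE => /(_ _ _ lm).
rewrite !(nth_map x0) -?cardE ?(leq_trans _ kT) //.
by apply; rewrite ?(leq_trans _ kT).
Qed.

(** * The Marcus-Tardos bound *)

Section Contraction.

Variables (k : nat) (p : 'S_k) (n m : nat) (bl : 'I_n -> 'I_m).
Hypothesis bl_homo : {homo bl : i j / i <= j}.

Definition contract (A : {set 'I_n * 'I_n}) : {set 'I_m * 'I_m} :=
  [set (bl a.1, bl a.2) | a in A].

Lemma bl_lt i j : bl i < bl j -> i < j.
Proof. by apply: contraTT; rewrite -!leqNgt; apply: bl_homo. Qed.

(** Choose one cell of [A] in each block of the copy: since [bl] is monotone, coordinates in
    distinct blocks are ordered as the blocks are. *)
Lemma contains_contract A : contains p (contract A) -> contains p A.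
Proof.
case/containsP=> r [c [rP cP BP]].
have {}BP l : exists a, [/\ a \in A, bl a.1 = r l & bl a.2 = c (p l)].
  by have /imsetP[a aA [-> ->]] := BP l; exists a.
have [f fP] := fin_all_exists BP; apply/containsP.
exists (fun l => (f l).1), (fun j => (f (p^-1 j)%g).2); split.
- by move=> l l' ll'; apply: bl_lt; case: (fP l) (fP l') => _ -> _ [_ -> _]; apply: rP.
- move=> l l' ll'; apply: bl_lt.
  by case: (fP (p^-1 l)%g) (fP (p^-1 l')%g) => _ _ -> [_ _ ->]; rewrite !permKV; apply: cP.
- by move=> l; rewrite permK -surjective_pairing; case: (fP l).
Qed.

Variable s : nat.
Hypothesis bl_fiber : forall x, #|[set i | bl i == x]| <= s.

(** The projection to the first axis of the part of [A] inside block [b]; the transposed matrix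
    supplies the other projection. *)
Definition shadow (A : {set 'I_n * 'I_n}) (b : 'I_m * 'I_m) : {set 'I_n} :=
  [set i | (bl i == b.1) && [exists j, (bl j == b.2) && ((i, j) \in A)]].

Lemma card_shadow A b : #|shadow A b| <= s.
Proof.
apply: leq_trans (bl_fiber b.1); apply: subset_leq_card.
by apply/subsetP => i; rewrite !inE => /andP[].
Qed.

(* If k blocks of one block column had the same shadow of size >= k, then k
   columns of that shadow would each meet all k blocks, giving a copy of p. *)
Lemma card_wide_column A x : ~~ contains p A ->
  #|[set y | k <= #|shadow A (x, y)|]| <= 2 ^ s * k.
Proof.
move=> NA; set Y := [set y | _].
have YP : {in Y, forall y, shadow A (x, y) \in powerset [set i | bl i == x]}.
  move=> y _; rewrite powersetE; apply/subsetP => i.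
  by rewrite !inE => /andP[].
(* Group the blocks by shadow. A shadow is a subset of a fiber of size at most [s], so there are at
   most [2 ^ s] groups, and each must have at most [k] members. *)
rewrite -sum1_card (partition_big _ _ YP) /=.
apply: (@leq_trans (\sum_(T in powerset [set i | bl i == x]) k)); last first.
  by rewrite sum_nat_const card_powerset leq_mul2r leq_exp2l ?bl_fiber ?orbT.
apply: leq_sum => T _; rewrite sum1dep_card.
rewrite leqNgt; apply: contra NA => kY'.
have [y [y_lt yY]] := increasing_in_set (ltnW kY').
have kT : k <= #|T|.
  case: (set_0Vmem [set x0 in Y | shadow A (x, x0) == T]) kY' => [-> |]; first by rewrite cards0.
  by case=> y0; rewrite !inE => /andP[+ /eqP <-].
have [t [t_lt tT]] := increasing_in_set kT.
have cP j : exists i, bl i = y j /\ (t (p^-1 j)%g, i) \in A.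
  have := tT (p^-1 j)%g; have := yY j; rewrite !inE => /andP[_ /eqP<-].
  by rewrite inE => /andP[_ /existsP[i /andP[/eqP ? ?]]]; exists i.
have [c {}cP] := fin_all_exists cP.
apply/containsP; exists t, c; split=> //.
- by move=> l l' ll'; apply: bl_lt; case: (cP l) (cP l') => -> _ [-> _]; apply: y_lt.
- by move=> l; have [_] := cP (p l); rewrite permK.
Qed.

Lemma card_wide A : ~~ contains p A ->
  #|[set b | k <= #|shadow A b|]| <= m * (2 ^ s * k).
Proof.
move=> NA.
rewrite -sum1_card (partition_big (fun b => b.1) predT) //=.
apply: (@leq_trans (\sum_(x < m) 2 ^ s * k)); last by rewrite sum_nat_const card_ord.
apply: leq_sum => x _; rewrite sum1dep_card.
apply: leq_trans (card_wide_column x NA).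
rewrite -[leqRHS](card_imset _ (can_inj (_ : cancel (pair x) snd))) //.
apply: subset_leq_card; apply/subsetP => -[x' y]; rewrite !inE /=.
by case/andP=> ky /eqP x'x; apply/imsetP; exists y; rewrite ?inE -x'x.
Qed.

End Contraction.

Section MarcusTardosStep.

Variables (k : nat) (p : 'S_k) (n m : nat) (bl : 'I_n -> 'I_m) (s : nat).
Hypothesis bl_homo : {homo bl : i j / i <= j}.
Hypothesis bl_fiber : forall x, #|[set i | bl i == x]| <= s.

Let tall A b := k <= #|shadow bl (transpose A) (b.2, b.1)|.
Let wide A b := k <= #|shadow bl A b|.

(** A block's content lies in the product of its two projections. If both are smaller than [k], the
    term [k ^ 2] suffices; otherwise a boolean equal to 1 pays for the whole block. *)
Lemma card_block (A : {set 'I_n * 'I_n}) b :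
  #|[set a in A | (bl a.1, bl a.2) == b]| <=
  k ^ 2 + s ^ 2 * wide A b + s ^ 2 * tall A b.
Proof.
have le_prod : #|[set a in A | (bl a.1, bl a.2) == b]| <=
    #|shadow bl A b| * #|shadow bl (transpose A) (b.2, b.1)|.
  rewrite -cardsX; apply: subset_leq_card; apply/subsetP => -[i j].
  rewrite !inE => /andP[ijA /eqP /= <-] /=.
  rewrite !eqxx /=; apply/andP; split; apply/existsP; [exists j|exists i]; rewrite eqxx //=.
  by rewrite mem_transpose.
apply: (leq_trans le_prod).
have := card_shadow bl_fiber A b.
have := card_shadow bl_fiber (transpose A) (b.2, b.1).
rewrite /wide /tall; move: #|_| #|_| => u v us vs.
have uv : v * u <= s ^ 2 by rewrite expnS expn1 leq_mul.
case: (leqP k v) => kv; first by rewrite muln1; lia.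
case: (leqP k u) => ku; first by rewrite !muln1; lia.
rewrite !muln0 !addn0 expnS expn1; apply: leq_mul; lia.
Qed.

(** Sum [card_block] over the nonempty blocks. Wide blocks are counted by [card_wide] for [A], tall
    ones by [card_wide] for its transpose and the inverse pattern. *)
Lemma card_avoiding_contract (A : {set 'I_n * 'I_n}) : ~~ contains p A ->
  #|A| <= k ^ 2 * #|contract bl A| + s ^ 2 * (m * (2 ^ s * k)) * 2.
Proof.
move=> NA.
have AB : {in A, forall a, (bl a.1, bl a.2) \in contract bl A}.
  by move=> a aA; apply/imsetP; exists a.
rewrite -sum1_card (partition_big _ _ AB) /=.
apply: (@leq_trans (\sum_(b in contract bl A)
   (k ^ 2 + s ^ 2 * wide A b + s ^ 2 * tall A b))).
  by apply: leq_sum => b _; rewrite sum1dep_card; apply: card_block.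
rewrite !big_split /= sum_nat_const -!big_distrr /= mulnC -addnA leq_add2l.
rewrite muln2 -addnn.
apply: leq_add; rewrite leq_mul2l; apply/orP; right.
  apply: leq_trans (card_wide bl_homo bl_fiber NA).
  rewrite -sum1dep_card big_mkcond [leqRHS]big_mkcond /=.
  by apply: leq_sum => b _; case: ifP => // _; rewrite /wide; case: leqP.
have NA' : ~~ contains p^-1%g (transpose A).
  by apply: contra NA; apply: contains_transpose.
apply: leq_trans (card_wide bl_homo bl_fiber NA').
rewrite -[leqRHS](card_imset _ (can_inj (_ : cancel (fun b => (b.2, b.1)) (fun b => (b.2, b.1))))); last by case.
rewrite (_ : [set _ | _ in _] = [set b | tall A b]).
  rewrite -sum1dep_card big_mkcond [leqRHS]big_mkcond /=.
  by apply: leq_sum => b _; case: ifP => // _; case: tall.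
apply/setP => -[x y]; rewrite [RHS]inE /tall /=; apply/imsetP/idP.
  by case=> -[u v]; rewrite inE => + [-> ->].
by move=> kxy; exists (y, x); rewrite ?inE.
Qed.

End MarcusTardosStep.

Lemma block_map s j : 0 < s ->
  exists bl : 'I_(s ^ j.+1) -> 'I_(s ^ j),
    {homo bl : a b / a <= b} /\ forall x, #|[set i | bl i == x]| <= s.
Proof.
move=> s_gt0.
have lt_div (i : 'I_(s ^ j.+1)) : i %/ s < s ^ j.
  by rewrite ltn_divLR // -expnSr ltn_ord.
exists (fun i => Ordinal (lt_div i)); split=> [a b ab|x]; first exact: leq_div2r.
rewrite -[leqRHS]card_ord.
apply: (@leq_card_in _ _ (fun i : 'I_(s ^ j.+1) => Ordinal (ltn_pmod i s_gt0))).
move=> a b; rewrite !inE => /eqP/(congr1 val) /= ax /eqP/(congr1 val) /= bx.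
move=> /(congr1 val) /= ab; apply: val_inj => /=.
by rewrite (divn_eq a s) (divn_eq b s) ax bx ab.
Qed.

(** * Size and number of avoiding matrices whose side is a power of [s] *)

Section Counting.

Variables (k : nat) (p : 'S_k).

(* The recursion |A| <= k^2 |B| + D m, with B the contraction of A to m x m
   blocks of side s, has a linear solution because k^2 + 1 <= s. *)
Let s := (k ^ 2).+2.
Let D := (s ^ 2 * (2 ^ s * k) * 2).+1.

Lemma card_avoiding j (A : {set 'I_(s ^ j) * 'I_(s ^ j)}) :
  ~~ contains p A -> #|A| <= D * s ^ j.
Proof.
elim: j A => [|j IHj] A NA.
  apply: leq_trans (max_card _) _.
  by rewrite card_prod card_ord.
have [bl [bl_homo bl_fiber]] := block_map j (isT : 0 < s).
apply: (leq_trans (card_avoiding_contract bl_homo bl_fiber NA)).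
have NB : ~~ contains p (contract bl A).
  by apply: contra NA; apply: contains_contract.
apply: (@leq_trans (k ^ 2 * (D * s ^ j) + D * s ^ j)).
  apply: leq_add; first by rewrite leq_mul2l IHj ?orbT.
  by rewrite mulnCA -mulnA mulnC leq_mul2r leqnSn orbT.
by rewrite addnC -mulSn (expnS s) [leqRHS]mulnCA leq_mul2r leqnSn orbT.
Qed.

(** An avoiding matrix is determined by its contraction [B], again avoiding, and a choice of cells
    within the blocks of [B]. By [card_avoiding] these blocks have at most [D * s ^ j * s ^ 2] cells
    in all. *)
Lemma num_avoiding j :
  #|[set A : {set 'I_(s ^ j) * 'I_(s ^ j)} | ~~ contains p A]|
    <= 2 ^ (D * s ^ 2 * s ^ j).
Proof.
elim: j => [|j IHj].
  apply: leq_trans (max_card _) _.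
  by rewrite -cardsT -powersetT card_powerset cardsT card_prod card_ord leq_exp2l.
have [bl [bl_homo bl_fiber]] := block_map j (isT : 0 < s).
pose cells (B : {set 'I_(s ^ j) * 'I_(s ^ j)}) :=
  [set a | (bl a.1, bl a.2) \in B].
have card_cells B : #|cells B| <= #|B| * s ^ 2.
  rewrite -sum1_card (partition_big (fun a => (bl a.1, bl a.2)) (mem B)) /=; last first.
    by move=> a; rewrite inE.
  rewrite -sum_nat_const; apply: leq_sum => b _; rewrite sum1dep_card.
  apply: (@leq_trans #|setX [set i | bl i == b.1] [set i | bl i == b.2]|).
    apply: subset_leq_card; apply/subsetP => -[i i'].
    by rewrite !inE => /andP[_ /eqP <-]; rewrite !eqxx.
  by rewrite cardsX -[leqRHS]mulnn leq_mul.
rewrite -sum1_card.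
rewrite (partition_big (contract bl) (mem [set B | ~~ contains p B])) /=; last first.
  by move=> A; rewrite !inE; apply: contra; apply: contains_contract.
apply: (@leq_trans (\sum_(B in [set B : {set 'I_(s ^ j) * 'I_(s ^ j)} | ~~ contains p B])
    2 ^ (D * s ^ j * s ^ 2))).
  apply: leq_sum => B; rewrite inE => NB; rewrite sum1dep_card.
  apply: (@leq_trans #|powerset (cells B)|).
    apply: subset_leq_card; apply/subsetP => A; rewrite !inE => /andP[_ /eqP <-].
    by apply/subsetP => a aA; rewrite inE; apply/imsetP; exists a.
  rewrite card_powerset leq_exp2l //; apply: leq_trans (card_cells B) _.
  by rewrite leq_mul2r card_avoiding ?orbT.
rewrite sum_nat_const; apply: (@leq_trans (2 ^ (D * s ^ 2 * s ^ j) * 2 ^ (D * s ^ j * s ^ 2))).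
  by rewrite leq_mul2r IHj orbT.
(* The exponent has doubled, while the claimed one has grown by the factor [s >= 2]. *)
rewrite -expnD leq_exp2l // (mulnAC D (s ^ j)) addnn -mul2n (expnS s j).
by rewrite [leqRHS]mulnCA leq_mul2r orbT.
Qed.

End Counting.

(** * From matrices to permutations *)

Definition graph n (sigma : 'S_n) : {set 'I_n * 'I_n} := [set (i, sigma i) | i : 'I_n].

Lemma mem_graph n (sigma : 'S_n) i j : ((i, j) \in graph sigma) = (sigma i == j).
Proof.
by apply/imsetP/eqP => [[x _ [-> ->]]|<-]; last exists i.
Qed.

Theorem stanley_wilf k (p : 'S_k) : exists c : nat, forall n,
  #|[set sigma : 'S_n | ~~ contains p (graph sigma)]| <= c ^ n.
Proof.
set s := (k ^ 2).+2; set D := (s ^ 2 * (2 ^ s * k) * 2).+1.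
exists (2 ^ (D * s ^ 2 * s)) => -[|n].
  by apply: leq_trans (max_card _) _; rewrite card_Sn.
have /andP[le_n lt_n] := trunc_log_bounds (isT : 1 < s) (isT : 0 < n.+1).
(* The least power of [s] above the length exceeds it by a factor of at most [s], whence the last
   factor in the constant. *)
set j := (trunc_log s n.+1).+1 in lt_n.
apply: (@leq_trans (2 ^ (D * s ^ 2 * s ^ j))); last first.
  by rewrite -expnM leq_exp2l // /j (expnS s (trunc_log _ _)) -[leqRHS]mulnA leq_mul2l leq_mul2l le_n !orbT.
(* Contracting along the injection [w] merely pads the matrix with empty rows and columns up to side
   [s ^ j], so [contains_contract] shows that avoidance persists. *)
pose w := widen_ord (ltnW lt_n).
have w_homo : {homo w : a b / a <= b} by [].
apply: leq_trans (num_avoiding p j).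
rewrite -(@card_in_imset _ _ (fun sigma : 'S_n.+1 => contract w (graph sigma))).
  apply: subset_leq_card; apply/subsetP => _ /imsetP[sigma + ->].
  by rewrite !inE; apply: contra; apply: contains_contract.
have ww_inj : injective (fun a => (w a.1, w a.2)).
  by move=> [a b] [a' b'] [/val_inj -> /val_inj ->].
move=> sigma tau _ _ /(imset_inj ww_inj) st; apply/permP => i.
by apply/esym/eqP; rewrite -mem_graph -st mem_graph.
Qed.

(** * Counting permutations containing a given pattern *)

Lemma is_patternP k n (rho : 'S_k) (sigma : 'S_n) :
  reflect (is_pattern rho sigma) (contains rho (graph sigma)).
Proof.
apply: (iffP (containsP _ _)) => [[r [c [rP cP AP]]]|[i [iP sP]]].
  exists r; split=> // l m lm.
  by have /eqP-> := etrans (esym (mem_graph _ _ _)) (AP l);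
     have /eqP-> := etrans (esym (mem_graph _ _ _)) (AP m); apply: cP.
exists i, (fun j => sigma (i (rho^-1 j)%g)); split=> [//|l m lm|l].
  by apply: sP; rewrite !permKV.
by rewrite mem_graph permK.
Qed.

Lemma is_pattern_trans j k n (rho : 'S_j) (pi : 'S_k) (sigma : 'S_n) :
  is_pattern rho pi -> is_pattern pi sigma -> is_pattern rho sigma.
Proof.
move=> [f [fP rP]] [g [gP sP]]; exists (g \o f); split=> l m lm /=.
  by apply/gP/fP.
by apply/sP/rP.
Qed.

(** Both maps enumerate the same set in increasing order, and a sorted list is determined by its
    elements. *)
Lemma increasing_image_eq k n (f g : 'I_k -> 'I_n) :
  {homo f : l m / l < m} -> {homo g : l m / l < m} ->
  f @: [set: 'I_k] = g @: [set: 'I_k] -> f =1 g.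
Proof.
have sorted_codom (h : 'I_k -> 'I_n) : {homo h : l m / l < m} ->
    sorted (relpre val ltn) (map h (enum 'I_k)).
  move=> h_homo; rewrite sorted_map.
  apply: (@sub_sorted _ (relpre val ltn)) => [x y|]; first exact: h_homo.
  by rewrite -sorted_map val_enum_ord iota_ltn_sorted.
move=> f_homo g_homo fg.
have /eq_in_map/[swap] l : map f (enum 'I_k) = map g (enum 'I_k).
  apply: (@irr_sorted_eq _ (relpre val ltn)).
  - by move=> ? ? ?; exact: ltn_trans.
  - by move=> ?; exact: ltnn.
  - exact: sorted_codom.
  - exact: sorted_codom.
  - move=> y; apply/mapP/mapP => -[x _ ->].
      have : f x \in g @: [set: 'I_k] by rewrite -fg imset_f.
      by case/imsetP => z _ ->; exists z; rewrite ?mem_enum.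
    have : g x \in f @: [set: 'I_k] by rewrite fg imset_f.
    by case/imsetP => z _ ->; exists z; rewrite ?mem_enum.
by apply; rewrite mem_enum.
Qed.

Definition occurrences k n (rho : 'S_k) (t : 'I_k -> 'I_n) : {set 'S_n} :=
  [set sigma : 'S_n |
    [forall l, forall m, (rho l < rho m) ==> (sigma (t l) < sigma (t m))]].

(* Composing with the k! permutations supported on the image of t yields
   pairwise distinct permutations: the values on that image determine the order. *)
Lemma card_occurrences k n (rho : 'S_k) (t : 'I_k -> 'I_n) :
  {homo t : l m / l < m} -> #|occurrences rho t| * k`! <= n`!.
Proof.
move=> t_homo; set T := t @: [set: 'I_k].
have t_inj : injective t.
  move=> l m tlm; apply/val_inj/eqP.
  by case: ltngtP => // /t_homo; rewrite tlm ltnn.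
have cardT : #|T| = k by rewrite card_imset // cardsT card_ord.
pose H := [set h : 'S_n | perm_on T h].
have cardH : #|H| = k`! by rewrite cardsE card_perm cardT.
have occ_homo sigma : sigma \in occurrences rho t ->
    {homo (fun l => sigma (t (rho^-1 l)%g)) : l m / l < m}.
  rewrite inE => /forallP occ l m lm.
  by have /forallP/(_ (rho^-1 m)%g)/implyP := occ (rho^-1 l)%g; rewrite !permKV; apply.
(* Since [h] permutes [T], the product [h * sigma] takes on [T] the same set of values as [sigma].
   Equal products thus give equal value sets, and [rho] fixes how these are arranged on [T]. *)
have im_occ (sigma h : 'S_n) : perm_on T h ->
    (fun l => sigma (t (rho^-1 l)%g)) @: [set: 'I_k] = (h * sigma)%g @: T.
  move=> hT; apply/setP => y; apply/imsetP/imsetP => [[l _ ->]|[x xT ->]].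
    exists (h^-1 (t (rho^-1 l)))%g; last by rewrite permM permKV.
    by rewrite -(perm_closed _ hT) permKV imset_f.
  have : h x \in T by rewrite perm_closed.
  by case/imsetP=> l _ hx; exists (rho l); rewrite ?permK // permM hx.
pose f (a : 'S_n * 'S_n) := (a.1 * a.2)%g.
rewrite mulnC -cardH -cardsX -card_Sn -(@card_in_imset _ _ f) ?max_card //.
move=> [h1 s1] [h2 s2]; rewrite !in_setX [_ \in H]inE [_ \in H in X in _ -> X]inE.
move=> /andP[/= h1T s1X] /andP[h2T s2X]; rewrite /f /= => hs.
have s12 x : x \in T -> s1 x = s2 x.
  case/imsetP=> l _ ->.
  have /(increasing_image_eq (occ_homo _ s1X) (occ_homo _ s2X))/(_ (rho l)) :
      (fun l => s1 (t (rho^-1 l)%g)) @: [set: 'I_k] =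
      (fun l => s2 (t (rho^-1 l)%g)) @: [set: 'I_k].
    by rewrite (im_occ _ _ h1T) (im_occ _ _ h2T) hs.
  by rewrite permK.
have h12 : h1 = h2.
  apply/permP => x; have [xT|xT] := boolP (x \in T); last by rewrite (out_perm h1T) // (out_perm h2T).
  apply: (@perm_inj _ s1); rewrite [RHS]s12 ?(perm_closed _ h2T) //.
  by rewrite -!permM hs.
by move: hs; rewrite h12 => /mulgI ->.
Qed.

Lemma card_bigcup_le (I T : finType) (P : pred I) (F : I -> {set T}) :
  #|\bigcup_(i | P i) F i| <= \sum_(i | P i) #|F i|.
Proof.
elim/big_rec2: _ => [|i m A _ IH]; first by rewrite cards0.
by apply: leq_trans (leq_card_setU _ _) _; rewrite leq_add2l.
Qed.

(** Union bound over the ['C(n, k)] increasing tuples of positions. *)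
Lemma card_containing k n (rho : 'S_k) :
  #|[set sigma : 'S_n | contains rho (graph sigma)]| * k`! <= 'C(n, k) * n`!.
Proof.
pose P := [set t : k.-tuple 'I_n | sorted ltn (map val t)].
have sub : [set sigma : 'S_n | contains rho (graph sigma)] \subset
    \bigcup_(t in P) occurrences rho (tnth t).
  apply/subsetP => sigma; rewrite inE => /is_patternP[i [iP sP]].
  apply/bigcupP; exists [tuple i l | l < k]; last first.
    rewrite inE; apply/forallP => l; apply/forallP => m; apply/implyP => lm.
    by rewrite !tnth_mktuple sP.
  rewrite inE /= -map_comp sorted_map.
  apply: (@sub_sorted _ (relpre val ltn)) => [x y|]; first exact: iP.
  by rewrite -sorted_map val_enum_ord iota_ltn_sorted.
apply: (@leq_trans ((\sum_(t in P) #|occurrences rho (tnth t)|) * k`!)).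
  by rewrite leq_mul2r (leq_trans (subset_leq_card sub)) ?card_bigcup_le ?orbT.
rewrite -card_ltn_sorted_tuples -/P big_distrl -sum_nat_const /=.
apply: leq_sum => t; rewrite inE => tP; apply: card_occurrences => l m lm.
have := sorted_ltn_nth ltn_trans 0 tP.
move=> /(_ l m); rewrite !inE size_map size_tuple => /(_ _ _ lm).
by rewrite !(nth_map (tnth t l)) ?size_tuple // -!tnth_nth; apply.
Qed.

Lemma exists_perm_missing k n (A : {set 'S_k}) :
  #|A| * 'C(n, k) < k`! ->
  exists sigma : 'S_n, forall rho, rho \in A -> ~~ contains rho (graph sigma).
Proof.
move=> small.
pose B := \bigcup_(rho in A) [set sigma : 'S_n | contains rho (graph sigma)].
have cardB : #|B| < n`!.
  rewrite -(ltn_pmul2r (fact_gt0 k)).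
  apply: (@leq_ltn_trans (#|A| * 'C(n, k) * n`!)); last first.
    by rewrite mulnC ltn_pmul2l ?fact_gt0.
  apply: (@leq_trans
    ((\sum_(rho in A) #|[set sigma : 'S_n | contains rho (graph sigma)]|) * k`!)).
    by rewrite leq_mul2r card_bigcup_le orbT.
  rewrite big_distrl -mulnA -sum_nat_const /=; apply: leq_sum => rho _.
  exact: card_containing.
have /set0Pn[sigma] : ~: B != set0.
  by rewrite -card_gt0 cardsCs setCK card_Sn subn_gt0.
rewrite inE => sB; exists sigma => rho rhoA; apply: contra sB => c_rho.
by apply/bigcupP; exists rho; rewrite ?inE.
Qed.

(** * Numerical estimates and the choice of the length *)

Lemma expnn_le_fact k : k ^ k <= 4 ^ k * k`!.
Proof.
have binle : 'C(k + k, k) <= 4 ^ k.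
  rewrite -[k + k in X in X <= _]card_ord -card_draws.
  apply: leq_trans (max_card _) _.
  by rewrite -cardsT -powersetT card_powerset cardsT card_ord addnn -mul2n expnM.
(* The falling factorial has [k] factors, each at least [k], and equals the central binomial
   coefficient times the factorial of [k]. *)
apply: (@leq_trans ((k + k) ^_ k)).
  rewrite ffact_prod (_ : k ^ k = \prod_(i < k) k); last by rewrite prod_nat_const card_ord.
  apply: leq_prod => i _; have := ltn_ord i; lia.
by rewrite -bin_ffact leq_mul2r binle orbT.
Qed.

Lemma bin_lt_fact c n k : 16 * c * n < k ^ 2 -> c ^ k * 'C(n, k) < k`!.
Proof.
move=> lt_k.
have k_gt0 : 0 < k by case: k lt_k.
have ffact_le : 'C(n, k) * k`! <= n ^ k.
  rewrite bin_ffact ffact_prod (_ : n ^ k = \prod_(i < k) n); last by rewrite prod_nat_const card_ord.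
  by apply: leq_prod => i _; apply: leq_subr.
(* After this scaling the left side is at most [(16 * c * n) ^ k], and the right side is the square
   of the bound in [expnn_le_fact], hence at least [(k ^ 2) ^ k]. *)
rewrite -(ltn_pmul2r (fact_gt0 k)) -(@ltn_pmul2l (16 ^ k)) ?expn_gt0 //.
apply: (@leq_ltn_trans ((16 * c * n) ^ k)).
  by rewrite !expnMn -!mulnA !leq_mul2l ffact_le !orbT.
apply: (@leq_trans ((k ^ 2) ^ k)); first by rewrite ltn_exp2r.
rewrite -expnM mulnC expnM -mulnn.
apply: leq_trans (leq_mul (expnn_le_fact k) (expnn_le_fact k)) _.
by rewrite mulnACA -expnMn.
Qed.

(* The pattern on the first k positions of pi, standardized by ranks. *)
Lemma pattern_of_length j k (pi : 'S_j) : k <= j -> exists rho : 'S_k, is_pattern rho pi.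
Proof.
move=> kj; pose w := widen_ord kj.
pose below l := [set m | pi (w m) < pi (w l)].
have below_lt l : #|below l| < k.
  rewrite -[X in _ < X]card_ord -cardsT; apply: proper_card.
  by apply/properP; split; [exact: subsetT | exists l; rewrite !inE ?ltnn].
pose r l := Ordinal (below_lt l).
have r_homo l m : pi (w l) < pi (w m) -> r l < r m.
  move=> lm; apply: proper_card; apply/properP; split.
    by apply/subsetP => x; rewrite !inE => /ltn_trans; apply.
  by exists l; rewrite !inE ?ltnn.
have r_inj : injective r.
  move=> l m rlm; suff /perm_inj/(congr1 val) lm : pi (w l) = pi (w m) by apply: val_inj.
  by apply/val_inj/eqP; case: ltngtP => // /r_homo; rewrite rlm ltnn.
exists (perm r_inj), w; split=> // l m; rewrite !permE.
apply: contraTT; rewrite -!leqNgt leq_eqVlt => /predU1P[/val_inj/perm_inj/(congr1 val) ml|/r_homo/ltnW//].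
by have -> : m = l by apply: val_inj.
Qed.

Lemma exists_perm_short_avoiders k (tau : 'S_k) :
  exists M, forall n, exists sigma : 'S_n, forall j (pi : 'S_j),
    avoids pi tau -> is_pattern pi sigma -> j ^ 2 <= M * n.
Proof.
have [c cP] := stanley_wilf tau; exists (16 * c) => n.
have ex_h : exists h, 16 * c * n < h ^ 2.
  by exists (16 * c * n).+1; rewrite -mulnn; nia.
(* With [h.+1] the least admissible length, missing all avoiders of that length forces [j <= h], and
   minimality then yields the quadratic bound without square roots. *)
case: (ex_minnP ex_h) => -[|h] hP h_min; first by [].
have [|sigma sP] := @exists_perm_missing h.+1 n [set rho : 'S_h.+1 | ~~ contains tau (graph rho)].
  by apply: leq_ltn_trans (bin_lt_fact hP); rewrite leq_mul2r cP orbT.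
exists sigma => j pi pi_avoids pi_sigma; have [hj|jh] := ltnP h j.
  have [rho rho_pi] := pattern_of_length pi hj.
  have /sP/negP[] : rho \in [set rho : 'S_h.+1 | ~~ contains tau (graph rho)].
    rewrite inE; apply/is_patternP => tau_rho.
    by apply: pi_avoids; apply: is_pattern_trans rho_pi.
  by apply/is_patternP; apply: is_pattern_trans pi_sigma.
rewrite leqNgt; apply/negP => lt_j.
by have := h_min _ lt_j; rewrite leqNgt ltnS jh.
Qed.

(* Asymptotics over the reals *)
From mathcomp Require Import all_order all_algebra.
From mathcomp Require Import all_classical all_reals all_analysis.
Import Order.TTheory GRing.Theory Num.Theory numFieldNormedType.Exports.
Local Open Scope classical_set_scope.
Local Open Scope ring_scope.

Lemma littleo_sqrt_growth (R : realType) (eps : R) (M : nat) (f : nat -> nat) :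
  0 < eps -> (forall n, (f n ^ 2 <= M * n)%N) ->
  (fun n : nat => (f n)%:R : R^o) =o_\oo
  (fun n : nat => n%:R `^ (2^-1 + eps) : R^o).
Proof.
move=> eps_gt0 fM; apply/eqoP => e e_gt0.
(* Squared, the goal follows from M n <= e^2 n^(1 + 2 eps), that is a <= n^(2 eps), which holds from
   [n >= B] on. *)
pose a := M%:R / e ^+ 2; pose B := a `^ (eps * 2)^-1.
have a_ge0 : 0 <= a by rewrite divr_ge0 ?ler0n ?exprn_ge0 ?ltW.
near=> n.
have n_ge1 : 1 <= n%:R :> R by near: n; exact: nbhs_infty_ger.
have n_ge : B <= n%:R by near: n; exact: nbhs_infty_ger.
have n_gt0 : 0 < n%:R :> R by apply: lt_le_trans n_ge1.
rewrite ger0_norm ?ler0n // ger0_norm ?powR_ge0 //.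
have e_ge0 := ltW e_gt0.
rewrite -(@ler_pXn2r _ 2) ?nnegrE ?ler0n ?mulr_ge0 ?powR_ge0 //.
apply: (@le_trans _ _ (M%:R * n%:R)); first by rewrite -natrX -natrM ler_nat.
rewrite exprMn -(@powR_mulrn _ (_ `^ _)) ?powR_ge0 // -powRrM mulrDl mulVf //.
rewrite powRD ?(gt_eqF n_gt0) ?implybT // (powRr1 (ltW n_gt0)) mulrA [leRHS]mulrAC.
rewrite ler_pM2r // mulrC -ler_pdivrMr ?exprn_gt0 // -/a.
have -> : a = B `^ (eps * 2) by rewrite -powRrM mulVf ?powRr1 // mulf_neq0 ?gt_eqF.
by apply: ge0_ler_powR; rewrite ?nnegrE ?powR_ge0 ?ler0n ?mulr_ge0 ?(ltW eps_gt0).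
Unshelve. all: by end_near.
Qed.

Theorem theorem3 (R : realType) (eps : R) (C : perm_class) :
  0 < eps -> pattern_avoiding_class C ->
  exists sigma : forall n : nat, 'S_n,
    forall (len : nat -> nat) (pi : forall n : nat, 'S_(len n)),
      (forall n : nat, longest_pattern_in C (sigma n) (pi n)) ->
      (fun n : nat => (len n)%:R : R^o) =o_\oo
      (fun n : nat => n%:R `^ (2^-1 + eps) : R^o).
Proof.
(* Every member of [C] avoids the first pattern [tau], so the bound for avoiders of [tau] applies to
   the longest patterns. *)
move=> eps_gt0 [[|tau taus] [taus_neq0 CP]]; first by [].
have [M /(_ _)/cid-/all_sig[sigma sigmaP]] := exists_perm_short_avoiders (tagged tau).
exists sigma => len pi piP; apply: (littleo_sqrt_growth (M := M)) => // n.
have [Cpi pi_sigma _] := piP n; apply: sigmaP pi_sigma.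
by apply: (proj1 (CP _ _) Cpi); rewrite mem_head.
Qed.
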